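(* Let $\phi(\alpha,\omega)\ge 0$ be a function on $(-\infty,0]\times\mathbb{R}$ with $\phi(\alpha,\omega)=\phi(\alpha,-\omega)$, and let $c(\alpha,\omega)$ be a zero-mean bidimensional complex Gaussian process on $(-\infty,0]\times\mathbb{R}$ such that $$\mathbb{E}[c(\alpha,\omega)\overline{c(\alpha',\omega')}]=\phi(\alpha,\omega)\,\delta(\alpha-\alpha')\,\delta(\omega-\omega'),\qquad \mathbb{E}[c(\alpha,\omega)c(\alpha',\omega')]=0,$$ where $\delta(\cdot)$ is the Dirac delta function. Let $$g(t)=\int_{-\infty}^0\int_{-\infty}^{\infty}|c(\alpha,\omega)|\,e^{\alpha t}\cos(\omega t+\angle c(\alpha,\omega))\,\mathrm{d}\omega\,\mathrm{d}\alpha,\qquad t\ge 0,$$ and let $K(t,s)=\mathbb{E}[g(t)g(s)]$ be its kernel (covariance) function. Then, for all $t,s\ge 0$, $$K(t,s)=\frac12\int_{-\infty}^0\int_{-\infty}^{\infty}\phi(\alpha,\omega)\,e^{\alpha(t+s)}\cos(\omega(t-s))\,\mathrm{d}\omega\,\mathrm{d}\alpha .$$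
   Context: $\angle x$ denotes the phase of $x\in\mathbb{C}$ and $\overline{x}$ its conjugate, so that $|c|\cos(\omega t+\angle c)=\mathrm{Re}(c\,e^{j\omega t})=\tfrac12\left(c\,e^{j\omega t}+\overline{c}\,e^{-j\omega t}\right)$, with $j$ the imaginary unit. The process $c(\alpha,\omega)$ is a white-noise type object: precisely, one works with a complex Gaussian process (random measure) $C$ with orthogonal increments on $(-\infty,0]\times\mathbb{R}$, formally $\mathrm{d}C(\alpha,\omega)=c(\alpha,\omega)\,\mathrm{d}\omega\,\mathrm{d}\alpha$, with $\mathbb{E}[\mathrm{d}C(\alpha,\omega)\overline{\mathrm{d}C(\alpha,\omega)}]=\phi(\alpha,\omega)\,\mathrm{d}\omega\,\mathrm{d}\alpha$ and vanishing pseudo-covariance $\mathbb{E}[\mathrm{d}C\,\mathrm{d}C]=0$; the integral defining $g(t)$ is then the stochastic integral $g(t)=\mathrm{Re}\int\!\!\int e^{\alpha t}e^{j\omega t}\,\mathrm{d}C(\alpha,\omega)$. It is implicitly assumed that $g(t)$ is well defined for the values of $t$ under consideration, i.e. that $\int\!\!\int\phi(\alpha,\omega)e^{2\alpha t}\,\mathrm{d}\omega\,\mathrm{d}\alpha<\infty$. The function $\phi$ is called the generalized power spectral density (GPSD) of $g$. *)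

(* Defs.v *)
From HB Require Import structures.
From mathcomp Require Import all_boot all_order all_algebra.
From mathcomp Require Import all_classical all_reals all_analysis.
From mathcomp Require Import complex.

Set Implicit Arguments.
Unset Strict Implicit.
Unset Printing Implicit Defensive.

Import Order.TTheory GRing.Theory Num.Theory.
Import numFieldNormedType.Exports.
Import Normc.

Local Open Scope classical_set_scope.
Local Open Scope complex_scope.
Local Open Scope ring_scope.

Section complex_random_variables.
Context {R : realType} {d : measure_display} {Omega : measurableType d}.
Variable P : probability Omega R.
Implicit Types (X : Omega -> R) (Z : Omega -> R[i]).

Definition complex_L2 Z : Prop :=
  (fun w => complex.Re (Z w)) \in Lfun P 2%:E /\
  (fun w => complex.Im (Z w)) \in Lfun P 2%:E.

(* Meaningful only when both components are integrable; it is applied below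
   to square-integrable variables and to products of two of them. *)
Definition complex_expectation Z : R[i] :=
  fine 'E_P[fun w => complex.Re (Z w)]%E +i*
  fine 'E_P[fun w => complex.Im (Z w)]%E.

(* Constants count as Gaussian. They are treated apart because
   [normal_prob m 0] is not the Dirac mass at [m]. *)
Definition gaussian X : Prop :=
  measurable_fun setT X /\
  exists m s : R, 0 <= s /\
    forall B : set R, measurable B ->
      P (X @^-1` B) = if s == 0 then \d_m B else normal_prob m s B.

Definition ms_cvg (Zn : nat -> Omega -> R[i]) Z : Prop :=
  (fun n => 'E_P[fun w => (normc (Zn n w - Z w) ^+ 2)%R]%E) @ \oo --> (0 : \bar R).

End complex_random_variables.

(* [measurableTypeR R] is [R] with its Borel sigma-algebra, in the form that
   [lebesgue_measure] expects; points are pairs (alpha, omega). *)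
Notation plane R := (measurableTypeR R * measurableTypeR R)%type.

Section random_measure.
Context {R : realType}.
Implicit Types (phi : plane R -> R) (A B : set (plane R)) (z : plane R).

Definition half_plane : set (plane R) := `]-oo, 0%R] `*` setT.

Definition leb2 : {measure set (plane R) -> \bar R} :=
  (@lebesgue_measure R \x @lebesgue_measure R)%E.

Definition control_measure phi A : \bar R :=
  (\int[leb2]_(z in A) (phi z)%:E)%E.

Definition admissible phi A : Prop :=
  [/\ measurable A, A `<=` half_plane & (control_measure phi A < +oo)%E].

(* A finite list of pairs (a_i, A_i) encodes the simple function
   sum_i a_i 1_(A_i); the sets A_i need not be disjoint. *)
Definition simple := seq (R[i] * set (plane R)).

Definition simple_admissible phi (s : simple) : Prop :=
  forall p, p \in s -> admissible phi p.2.

Definition simple_fun (s : simple) z : R[i] :=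
  \sum_(p <- s) p.1 * (\1_(p.2) z)%:C.

Context {d : measure_display} {Omega : measurableType d}.
Variable P : probability Omega R.
Implicit Types (C : set (plane R) -> Omega -> R[i]) (Z : Omega -> R[i]).

Definition simple_integral C (s : simple) (w : Omega) : R[i] :=
  \sum_(p <- s) p.1 * C p.2 w.

(* The rigorous meaning of dC(alpha, omega) = c(alpha, omega) domega dalpha:
   the delta-correlations of c, integrated over A x B, become
   E[C(A) conj C(B)] = int_(A n B) phi and E[C(A) C(B)] = 0.
   Joint Gaussianity of all the real and imaginary parts is expressed by
   real parts of complex linear combinations, which are exactly the real
   linear combinations of those parts. Only the values of C on admissible
   sets matter. *)
Record gaussian_random_measure phi C : Prop := {
  grm_L2 : forall A, admissible phi A -> complex_L2 P (C A);
  grm_mean0 : forall A, admissible phi A -> complex_expectation P (C A) = 0;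
  grm_gaussian : forall s, simple_admissible phi s ->
    gaussian P (fun w => complex.Re (simple_integral C s w));
  grm_additive : forall F : nat -> set (plane R),
    (forall k, admissible phi (F k)) -> trivIset setT F ->
    admissible phi (\bigcup_k F k) ->
    ms_cvg P (fun n w => \sum_(k < n) C (F k) w) (C (\bigcup_k F k));
  grm_cov : forall A B, admissible phi A -> admissible phi B ->
    complex_expectation P (fun w => C A w * (C B w)^*%C) =
    (fine (control_measure phi (A `&` B)))%:C;
  grm_pseudocov : forall A B, admissible phi A -> admissible phi B ->
    complex_expectation P (fun w => C A w * C B w) = 0
}.

(* Z is a version of the Wiener integral of f against C: the mean-square
   limit of the integrals of simple functions converging to f in
   L2(phi domega dalpha). *)
Definition is_stochastic_integral phi C (f : plane R -> R[i]) Z : Prop :=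
  complex_L2 P Z /\
  exists s : nat -> simple,
    [/\ forall n, simple_admissible phi (s n),
        (fun n => \int[leb2]_(z in half_plane)
           (normc (simple_fun (s n) z - f z) ^+ 2 * phi z)%:E)%E @ \oo
             --> (0 : \bar R)
      & ms_cvg P (fun n => simple_integral C (s n)) Z].

(* e^(alpha t) e^(j omega t) *)
Definition damped_exponential (t : R) z : R[i] :=
  (expR (z.1 * t))%:C * (cos (z.2 * t) +i* sin (z.2 * t)).

Definition well_defined_at phi (t : R) : Prop :=
  (\int[lebesgue_measure]_(a in `]-oo, 0%R]) \int[lebesgue_measure]_(omega in setT)
     (phi (a, omega) * expR (2 * a * t))%:E < +oo)%E.

(* g(t) = int int |c| e^(alpha t) cos(omega t + arg c) domega dalpha, read
   through |c| cos(omega t + arg c) = Re(c e^(j omega t)) as the real part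
   of a stochastic integral, at the times t >= 0 where that integral
   exists. *)
Definition damped_oscillation_process phi C (g : R -> Omega -> R) : Prop :=
  forall t, 0 <= t -> well_defined_at phi t ->
    exists Z, is_stochastic_integral phi C (damped_exponential t) Z /\
              g t = fun w => complex.Re (Z w).

Definition process_kernel (g : R -> Omega -> R) (t s : R) : \bar R :=
  'E_P[fun w => (g t w * g s w)%R]%E.

End random_measure.

(* Main.v *)
Require Import Defs.
From HB Require Import structures.
From mathcomp Require Import all_boot all_order all_algebra.
From mathcomp Require Import all_classical all_reals all_analysis.
From mathcomp Require Import complex.
From mathcomp Require Import measurable_realfun.
From mathcomp Require Import ring lra.

Set Implicit Arguments.
Unset Strict Implicit.
Unset Printing Implicit Defensive.

Import Order.TTheory GRing.Theory Num.Theory.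
Import numFieldNormedType.Exports.

Local Open Scope classical_set_scope.
Local Open Scope ring_scope.

(** Write g(t) = Re Z_t, where Z_t is the Wiener integral of
    f_t(alpha, omega) = e^(alpha t) e^(j omega t) against C. The algebraic
    identity Re Z Re Z' = Re (Z conj Z' + Z Z') / 2 suggests the result:
    the Ito isometry gives E[Z_t conj Z_s] = int f_t conj f_s phi, the vanishing
    pseudo-covariance gives E[Z_t Z_s] = 0, and
    Re (f_t conj f_s) = e^(alpha (t + s)) cos (omega (t - s)).

    The proof carries this out with real inner products only. For the value of
    C on two sets, the covariance and pseudo-covariance equations are solved
    for the products of real and imaginary parts
    ([noise_component_products]). Expanding bilinearly gives
    E[Re I(f) Re I(f')] = (1/2) int Re (f conj f') phi for simple f and f'
    ([simple_integral_isometry]). By Cauchy-Schwarz both sides are continuous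
    for mean-square convergence ([inner_product_cvg]), and the identity extends
    to all stochastic integrals ([stochastic_integral_isometry]).
    Multiplying by the square root of phi on the half-plane makes the spectral
    side an L2 inner product for Lebesgue measure, so that the same continuity
    lemma serves on the probability space and on the plane.

    What remains is to see that f_t is square-integrable against phi, which is
    Tonelli applied to the assumption that g(t) is well defined
    ([damped_exponential_spectral_L2]), and to turn the plane integral into the
    iterated one by Fubini ([spectral_product_damped_exponential]). *)

(** * The real L2 inner product *)

Section inner_product.
Context {d : measure_display} {T : measurableType d} {R : realType}.
Variable mu : {measure set T -> \bar R}.
Implicit Types (f g h : T -> R).

Definition inner_product f g : R := \int[mu]_x (f x * g x).
Notation "<[ f , g ]>" := (inner_product f g).

Let L2 := Lfun mu 2%:E.

Lemma Lfun2_measurable f : f \in L2 -> measurable_fun setT f.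
Proof. by rewrite inE => /andP[/[!inE]]. Qed.

Lemma Lfun2_finite_sqr_integral f : measurable_fun setT f ->
  (\int[mu]_x (f x ^+ 2)%:E < +oo)%E -> f \in L2.
Proof.
move=> mf fy; rewrite inE; apply/andP; split; rewrite inE//=.
rewrite /finite_norm unlock /Lnorm poweR_lty//.
rewrite (eq_integral (fun x => (f x ^+ 2)%:E))// => x _.
by rewrite /= powR_mulrn// -normrX ger0_norm ?sqr_ge0.
Qed.

Lemma Lfun2D f g : f \in L2 -> g \in L2 -> (fun x => f x + g x) \in L2.
Proof. by move=> fL gL; apply: (rpredD fL gL); rewrite lee1n. Qed.

Lemma Lfun2Z a f : f \in L2 -> (fun x => a * f x) \in L2.
Proof.
move=> fL; have -> : (fun x => a * f x) = a \o* f.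
  by apply/funext => x /=; rewrite mulrC.
by apply: Lfun_scale => //; rewrite ler1n.
Qed.

Lemma Lfun2B f g : f \in L2 -> g \in L2 -> (fun x => f x - g x) \in L2.
Proof. by move=> fL gL; apply: (rpredB fL gL); rewrite lee1n. Qed.

Lemma Lfun2_sum (I : eqType) (r : seq I) (F : I -> T -> R) :
  (forall i, i \in r -> F i \in L2) -> (fun x => \sum_(i <- r) F i x) \in L2.
Proof.
move=> FL.
have -> : (fun x => \sum_(i <- r) F i x) = \sum_(i <- r) F i.
  by apply/funext => x; rewrite fct_sumE.
by rewrite big_seq; apply: rpred_sum => //; rewrite lee1n.
Qed.

Lemma Lfun2_mul_integrable f g : f \in L2 -> g \in L2 ->
  mu.-integrable setT (EFin \o (fun x => f x * g x)).
Proof. by move=> fL gL; exact/Lfun1_integrable/Lfun2_mul_Lfun1. Qed.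

Lemma inner_productC f g : <[f, g]> = <[g, f]>.
Proof. by apply: eq_Rintegral => x _; rewrite mulrC. Qed.

Lemma inner_productDl f g h : f \in L2 -> g \in L2 -> h \in L2 ->
  <[fun x => f x + g x, h]> = <[f, h]> + <[g, h]>.
Proof.
move=> fL gL hL; rewrite -RintegralD//; try exact: Lfun2_mul_integrable.
by apply: eq_Rintegral => x _; rewrite mulrDl.
Qed.

Lemma inner_productZl a f g : f \in L2 -> g \in L2 ->
  <[fun x => a * f x, g]> = a * <[f, g]>.
Proof.
move=> fL gL; rewrite -RintegralZl//; try exact: Lfun2_mul_integrable.
by apply: eq_Rintegral => x _; rewrite mulrA.
Qed.

Lemma inner_productZr a f g : f \in L2 -> g \in L2 ->
  <[f, fun x => a * g x]> = a * <[f, g]>.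
Proof. by move=> fL gL; rewrite !(inner_productC f) inner_productZl. Qed.

Lemma inner_productBl f g h : f \in L2 -> g \in L2 -> h \in L2 ->
  <[fun x => f x - g x, h]> = <[f, h]> - <[g, h]>.
Proof.
move=> fL gL hL; rewrite -RintegralB//; try exact: Lfun2_mul_integrable.
by apply: eq_Rintegral => x _; rewrite mulrBl.
Qed.

Lemma inner_productBr f g h : f \in L2 -> g \in L2 -> h \in L2 ->
  <[h, fun x => f x - g x]> = <[h, f]> - <[h, g]>.
Proof. by move=> fL gL hL; rewrite !(inner_productC h) inner_productBl. Qed.

Lemma inner_product_suml (I : eqType) (r : seq I) (F : I -> T -> R) g :
  (forall i, i \in r -> F i \in L2) -> g \in L2 ->
  <[fun x => \sum_(i <- r) F i x, g]> = \sum_(i <- r) <[F i, g]>.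
Proof.
move=> + gL; elim: r => [|i r IH] FL.
  rewrite big_nil /inner_product -[RHS](mul0r (fine (mu setT))).
  rewrite -Rintegral_cst//.
  by apply: eq_Rintegral => x _; rewrite big_nil mul0r.
have Fr j : j \in r -> F j \in L2 by move=> jr; apply: FL; rewrite inE jr orbT.
rewrite big_cons -IH// -inner_productDl//; last 2 first.
- by apply: FL; rewrite mem_head.
- exact: Lfun2_sum.
by congr (<[_, _]>); apply/funext => x; rewrite big_cons.
Qed.

Lemma inner_product_sum (I J : eqType) (r : seq I) (s : seq J)
    (F : I -> T -> R) (G : J -> T -> R) :
  (forall i, i \in r -> F i \in L2) -> (forall j, j \in s -> G j \in L2) ->
  <[fun x => \sum_(i <- r) F i x, fun x => \sum_(j <- s) G j x]> =
  \sum_(i <- r) \sum_(j <- s) <[F i, G j]>.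
Proof.
move=> FL GL; rewrite inner_product_suml//; last exact: Lfun2_sum.
rewrite big_seq [RHS]big_seq; apply: eq_bigr => i ir.
rewrite inner_productC inner_product_suml//; last exact: FL.
by apply: eq_bigr => j _; rewrite inner_productC.
Qed.

Lemma inner_product_ge0 f : 0 <= <[f, f]>.
Proof. by apply: Rintegral_ge0 => x _; rewrite -expr2 sqr_ge0. Qed.

(** The usual discriminant argument: the quadratic form
    (a, b) |-> <[a f + b g, a f + b g]> is nonnegative. *)
Lemma cauchy_schwarz f g : f \in L2 -> g \in L2 ->
  `|<[f, g]>| <= Num.sqrt <[f, f]> * Num.sqrt <[g, g]>.
Proof.
move=> fL gL.
have expand a b : 0 <= a ^+ 2 * <[f, f]> + 2 * (a * b) * <[f, g]> +
    b ^+ 2 * <[g, g]>.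
  have aL := Lfun2Z a fL; have bL := Lfun2Z b gL.
  have abL := Lfun2D aL bL.
  have := inner_product_ge0 (fun x => a * f x + b * g x).
  rewrite inner_productDl// !inner_productZl//.
  rewrite ![<[_, fun x => _ + _]>]inner_productC !inner_productDl//.
  rewrite !inner_productZl// (inner_productC g f); lra.
rewrite -sqrtrM ?inner_product_ge0// -sqrtr_sqr ler_sqrt; last first.
  by rewrite mulr_ge0 ?inner_product_ge0.
have f0 := inner_product_ge0 f; have g0 := inner_product_ge0 g.
move: f0 g0 expand; set F := <[f, f]>; set G := <[g, g]>; set H := <[f, g]>.
move=> f0 g0 expand.
(* For G > 0 the form is evaluated at (G, - H), where it equals
   G (F G - H ^ 2). For G = 0 it is affine in b, and b below is chosen to
   make it equal to -1 if H were nonzero. *)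
case: (eqVneq G 0) => [G0|Gn0]; last first.
  have Gp : 0 < G by rewrite lt_neqAle eq_sym Gn0.
  rewrite -subr_ge0 -(pmulr_rge0 _ Gp); have := expand G (- H); lra.
have [->|Hn0] := eqVneq H 0; first by rewrite G0 mulr0 expr2 mulr0.
have := expand 1 (- (F + 1) / (2 * H)); rewrite G0.
rewrite [X in 0 <= X](_ : _ = - 1); last by field.
by rewrite ler0N1.
Qed.

(** Mean-square convergence of both arguments suffices because
    <[fn, gn]> - <[f, g]> = <[fn - f, gn - g]> + <[fn - f, g]> + <[f, gn - g]>
    and Cauchy-Schwarz bounds each of the three terms. *)
Lemma inner_product_cvg (fn gn : nat -> T -> R) f g :
  (forall n, fn n \in L2) -> f \in L2 -> (forall n, gn n \in L2) -> g \in L2 ->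
  <[fun x => fn n x - f x, fun x => fn n x - f x]> @[n --> \oo] --> (0 : R) ->
  <[fun x => gn n x - g x, fun x => gn n x - g x]> @[n --> \oo] --> (0 : R) ->
  <[fn n, gn n]> @[n --> \oo] --> <[f, g]>.
Proof.
move=> fnL fL gnL gL df dg.
set Df := (fun n => <[fun x => fn n x - f x, fun x => fn n x - f x]>) in df.
set Dg := (fun n => <[fun x => gn n x - g x, fun x => gn n x - g x]>) in dg.
have sf : Num.sqrt (Df n) @[n --> \oo] --> (0 : R).
  rewrite -[X in _ --> X]sqrtr0; apply: continuous_cvg => //.
  exact: sqrt_continuous.
have sg : Num.sqrt (Dg n) @[n --> \oo] --> (0 : R).
  rewrite -[X in _ --> X]sqrtr0; apply: continuous_cvg => //.
  exact: sqrt_continuous.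
pose B n := Num.sqrt (Df n) * Num.sqrt (Dg n) +
  Num.sqrt (Df n) * Num.sqrt <[g, g]> + Num.sqrt <[f, f]> * Num.sqrt (Dg n).
have B0 : B n @[n --> \oo] --> (0 : R).
  rewrite [X in _ --> X](_ : _ = 0 * 0 + 0 * Num.sqrt <[g, g]> +
    Num.sqrt <[f, f]> * 0); last by rewrite !(mul0r, mulr0) !addr0.
  apply: cvgD; [apply: cvgD|]; apply: cvgM => //; exact: cvg_cst.
apply/subr_cvg0/norm_cvg0P; apply: (@squeeze_cvgr _ _ _ _ (fun=> 0) B) => //.
- apply: nearW => n; rewrite normr_ge0/=.
  have dfL := Lfun2B (fnL n) fL; have dgL := Lfun2B (gnL n) gL.
  have -> : <[fn n, gn n]> - <[f, g]> =
    <[fun x => fn n x - f x, fun x => gn n x - g x]> +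
    <[fun x => fn n x - f x, g]> + <[f, fun x => gn n x - g x]>.
    by rewrite !inner_productBl// !inner_productBr//; ring.
  apply: (le_trans (ler_normD _ _)); apply: lerD; last exact: cauchy_schwarz.
  by apply: (le_trans (ler_normD _ _)); apply: lerD; exact: cauchy_schwarz.
- exact: cvg_cst.
Qed.

End inner_product.

(** * Components of complex numbers *)

Section complex_components.
Context {R : rcfType}.
Implicit Types (x y : R[i]).

Lemma normc_sqr x : Normc.normc x ^+ 2 = complex.Re x ^+ 2 + complex.Im x ^+ 2.
Proof. by case: x => a b /=; rewrite sqr_sqrtr// addr_ge0 ?sqr_ge0. Qed.

Lemma Re_subc x y : complex.Re (x - y) = complex.Re x - complex.Re y.
Proof. by case: x y => [? ?] [? ?]. Qed.

Lemma Im_subc x y : complex.Im (x - y) = complex.Im x - complex.Im y.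
Proof. by case: x y => [? ?] [? ?]. Qed.

Lemma Re_mulc x y : complex.Re (x * y) =
  complex.Re x * complex.Re y - complex.Im x * complex.Im y.
Proof. by case: x y => [? ?] [? ?]. Qed.

Lemma Im_mulc x y : complex.Im (x * y) =
  complex.Re x * complex.Im y + complex.Im x * complex.Re y.
Proof. by case: x y => [? ?] [? ?]. Qed.

Lemma Re_conjc x : complex.Re (x^*)%C = complex.Re x.
Proof. by case: x. Qed.

Lemma Im_conjc x : complex.Im (x^*)%C = - complex.Im x.
Proof. by case: x. Qed.

Lemma Re_sumc (I : Type) (r : seq I) (F : I -> R[i]) :
  complex.Re (\sum_(i <- r) F i) = \sum_(i <- r) complex.Re (F i).
Proof. by apply: (big_morph (@complex.Re R)) => // -[? ?] [? ?]. Qed.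

Lemma Im_sumc (I : Type) (r : seq I) (F : I -> R[i]) :
  complex.Im (\sum_(i <- r) F i) = \sum_(i <- r) complex.Im (F i).
Proof. by apply: (big_morph (@complex.Im R)) => // -[? ?] [? ?]. Qed.

End complex_components.

(** * Mean-square convergence by components *)

Section mean_square.
Context {d : measure_display} {T : measurableType d} {R : realType}.
Variable mu : {measure set T -> \bar R}.

(** Extracts the convergence of one real component from that of a squared
    complex modulus; exchanging the two pairs gives the other component. *)
Lemma inner_product_sub_cvg0 (fn gn : nat -> T -> R) f g :
  (forall n, fn n \in Lfun mu 2%:E) -> f \in Lfun mu 2%:E ->
  (forall n, gn n \in Lfun mu 2%:E) -> g \in Lfun mu 2%:E ->
  (\int[mu]_x ((fn n x - f x) ^+ 2 + (gn n x - g x) ^+ 2)%:E)%E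
    @[n --> \oo] --> (0 : \bar R)%E ->
  inner_product mu (fun x => fn n x - f x) (fun x => fn n x - f x)
    @[n --> \oo] --> (0 : R).
Proof.
move=> fnL fL gnL gL e0.
have mf n : measurable_fun setT (fun x => (fn n x - f x) ^+ 2).
  by apply: measurable_funX; exact/Lfun2_measurable/Lfun2B.
have mg n : measurable_fun setT (fun x => (gn n x - g x) ^+ 2).
  by apply: measurable_funX; exact/Lfun2_measurable/Lfun2B.
suff : (\int[mu]_x ((fn n x - f x) ^+ 2)%:E)%E @[n --> \oo] --> (0 : \bar R)%E.
  by move/fine_cvg.
apply: squeeze_cvge (cvg_cst _) e0; apply: nearW => n.
rewrite integral_ge0/= => [|x _]; last by rewrite lee_fin sqr_ge0.
apply: ge0_le_integral => //.
- by move=> x _; rewrite lee_fin sqr_ge0.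
- exact/measurable_EFinP.
- by apply/measurable_EFinP/measurable_funD.
- by move=> x _; rewrite lee_fin lerDl sqr_ge0.
Qed.

End mean_square.

(** * The inner product on the spectral side *)

Lemma measurable_half_plane (R : realType) : measurable (@half_plane R).
Proof. exact: measurableX. Qed.

Section spectral_product.
Context {R : realType}.
Variable phi : plane R -> R.
Hypothesis phi_meas : measurable_fun half_plane phi.
Hypothesis phi_ge0 : forall z, half_plane z -> 0 <= phi z.
Implicit Types (f g : plane R -> R[i]) (A B : set (plane R)).

(** The square root is split between the two arguments of an inner product, so
    that L2(phi d omega d alpha) embeds into L2 of the plane for the plain
    Lebesgue measure, where the real inner product above applies. *)
Definition spectral_weight : plane R -> R :=
  (fun z => Num.sqrt (phi z)) \_ half_plane.
Notation w := spectral_weight.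

Lemma measurable_spectral_weight : measurable_fun setT w.
Proof.
apply/(measurable_restrictT _ _).1; first exact: measurable_half_plane.
apply: measurableT_comp => //; apply: continuous_measurable_fun.
exact: sqrt_continuous.
Qed.

Lemma spectral_weight_sqr z : w z ^+ 2 = (phi \_ half_plane) z.
Proof.
rewrite /w !patchE; case: ifPn => [/set_mem hz|_]; last by rewrite expr0n.
by rewrite sqr_sqrtr// phi_ge0.
Qed.

Definition weighted (f : plane R -> R) z : R := w z * f z.

Notation Re_ f := (weighted (fun z => complex.Re (f z))).
Notation Im_ f := (weighted (fun z => complex.Im (f z))).

(** Real part of the hermitian product, int Re (f conj g) phi. *)
Definition spectral_product f g : R :=
  inner_product leb2 (Re_ f) (Re_ g) + inner_product leb2 (Im_ f) (Im_ g).

Definition spectral_L2 f :=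
  Re_ f \in Lfun leb2 2%:E /\ Im_ f \in Lfun leb2 2%:E.

Lemma weighted_indic_sqr A : A `<=` half_plane ->
  (\int[leb2]_z (weighted \1_A z ^+ 2)%:E = control_measure phi A)%E.
Proof.
move=> Ah; rewrite /control_measure [RHS]integral_mkcond.
apply: eq_integral => z _.
rewrite /weighted exprMn spectral_weight_sqr !patchE indicE.
case: (boolP (z \in A)) => [/set_mem zA|_]; last by rewrite expr0n mulr0.
by rewrite mem_set ?expr1n ?mulr1//; exact: Ah.
Qed.

Lemma weighted_indic_Lfun2 A : admissible phi A ->
  weighted \1_A \in Lfun leb2 2%:E.
Proof.
move=> [mA Ah Ay]; apply: Lfun2_finite_sqr_integral; last first.
  by rewrite weighted_indic_sqr.
by apply: measurable_funM => //; exact: measurable_spectral_weight.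
Qed.

(** Turns the control measure of an intersection, which is what the random
    measure produces, into an inner product. *)
Lemma inner_product_weighted_indic A B :
  admissible phi A -> admissible phi B ->
  inner_product leb2 (weighted \1_A) (weighted \1_B) =
  fine (control_measure phi (A `&` B)).
Proof.
move=> [mA Ah Ay] [mB Bh By].
rewrite -weighted_indic_sqr => [|z [/Ah]//].
congr fine; apply: eq_integral => z _; congr EFin.
rewrite /weighted !indicE in_setI.
by case: (z \in A); case: (z \in B); rewrite /=; ring.
Qed.

Lemma weighted_Re_simple s : Re_ (simple_fun s) =
  fun z => \sum_(p <- s) complex.Re p.1 * weighted \1_(p.2) z.
Proof.
apply/funext => z; rewrite /weighted Re_sumc mulr_sumr.
by apply: eq_bigr => p _; rewrite Re_mulc/=; ring.
Qed.

Lemma weighted_Im_simple s : Im_ (simple_fun s) =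
  fun z => \sum_(p <- s) complex.Im p.1 * weighted \1_(p.2) z.
Proof.
apply/funext => z; rewrite /weighted Im_sumc mulr_sumr.
by apply: eq_bigr => p _; rewrite Im_mulc/=; ring.
Qed.

Lemma simple_spectral_L2 s : simple_admissible phi s ->
  spectral_L2 (simple_fun s).
Proof.
move=> sa; split; rewrite ?weighted_Re_simple ?weighted_Im_simple;
by apply: Lfun2_sum => p ps; apply/Lfun2Z/weighted_indic_Lfun2/sa.
Qed.

(** Both this expansion and the covariance of two simple integrals are double
    sums over the terms, so that comparing them reduces to single sets. *)
Lemma spectral_product_simple s s' :
  simple_admissible phi s -> simple_admissible phi s' ->
  spectral_product (simple_fun s) (simple_fun s') =
  \sum_(p <- s) \sum_(q <- s')
    (complex.Re p.1 * complex.Re q.1 + complex.Im p.1 * complex.Im q.1) *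
    fine (control_measure phi (p.2 `&` q.2)).
Proof.
move=> sa s'a; rewrite /spectral_product.
rewrite !(weighted_Re_simple, weighted_Im_simple).
rewrite !inner_product_sum; try by
  move=> p ps; apply/Lfun2Z/weighted_indic_Lfun2; (exact: sa || exact: s'a).
rewrite -big_split big_seq [RHS]big_seq; apply: eq_bigr => p /sa pa.
rewrite -big_split big_seq [RHS]big_seq; apply: eq_bigr => q /s'a qa /=.
have pL := weighted_indic_Lfun2 pa; have qL := weighted_indic_Lfun2 qa.
rewrite -inner_product_weighted_indic//.
rewrite !(inner_productZl, inner_productZr)//; try exact: Lfun2Z.
ring.
Qed.

Lemma spectral_product_cvg (fn gn : nat -> plane R -> R[i]) f g :
  (forall n, spectral_L2 (fn n)) -> spectral_L2 f ->
  (forall n, spectral_L2 (gn n)) -> spectral_L2 g ->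
  (\int[leb2]_(z in half_plane)
     (Normc.normc (fn n z - f z) ^+ 2 * phi z)%:E)%E
    @[n --> \oo] --> (0 : \bar R)%E ->
  (\int[leb2]_(z in half_plane)
     (Normc.normc (gn n z - g z) ^+ 2 * phi z)%:E)%E
    @[n --> \oo] --> (0 : \bar R)%E ->
  spectral_product (fn n) (gn n) @[n --> \oo] --> spectral_product f g.
Proof.
have comp (hn : nat -> plane R -> R[i]) h :
    (forall n, spectral_L2 (hn n)) -> spectral_L2 h ->
    (\int[leb2]_(z in half_plane)
     (Normc.normc (hn n z - h z) ^+ 2 * phi z)%:E)%E
    @[n --> \oo] --> (0 : \bar R)%E ->
    inner_product leb2 (fun z => Re_ (hn n) z - Re_ h z)
      (fun z => Re_ (hn n) z - Re_ h z) @[n --> \oo] --> (0 : R) /\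
    inner_product leb2 (fun z => Im_ (hn n) z - Im_ h z)
      (fun z => Im_ (hn n) z - Im_ h z) @[n --> \oo] --> (0 : R).
  move=> hnL [hRe hIm] h0.
  have normc_split n : (\int[leb2]_(z in half_plane)
      (Normc.normc (hn n z - h z) ^+ 2 * phi z)%:E =
      \int[leb2]_z ((Re_ (hn n) z - Re_ h z) ^+ 2 +
                    (Im_ (hn n) z - Im_ h z) ^+ 2)%:E)%E.
    rewrite [LHS]integral_mkcond; apply: eq_integral => z _.
    rewrite restrict_EFin /=; congr EFin.
    rewrite /weighted -!mulrBr !exprMn -mulrDr spectral_weight_sqr.
    rewrite !patchE normc_sqr Re_subc Im_subc.
    by case: ifPn => _; rewrite ?mul0r// mulrC.
  move: h0; under eq_fun do rewrite normc_split; move=> h0.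
  have hnRe n := (hnL n).1; have hnIm n := (hnL n).2.
  split; first exact: inner_product_sub_cvg0 h0.
  apply: inner_product_sub_cvg0 (hnIm) hIm (hnRe) hRe _.
  by under eq_fun do under eq_integral do rewrite addrC.
move=> fnL fL gnL gL /(comp _ _ fnL fL)[fRe fIm] /(comp _ _ gnL gL)[gRe gIm].
have fnRe n := (fnL n).1; have fnIm n := (fnL n).2.
have gnRe n := (gnL n).1; have gnIm n := (gnL n).2.
case: fL gL => [? ?] [? ?].
by apply: cvgD; apply: inner_product_cvg.
Qed.

End spectral_product.

(** * The isometry for simple integrands *)

Section simple_isometry.
Context {R : realType} {d : measure_display} {Omega : measurableType d}.
Variables (P : probability Omega R) (phi : plane R -> R).
Variable C : set (plane R) -> Omega -> R[i].
Hypothesis phi_meas : measurable_fun half_plane phi.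
Hypothesis phi_ge0 : forall z, half_plane z -> 0 <= phi z.
Hypothesis C_noise : gaussian_random_measure P phi C.

Notation X A := (fun w => complex.Re (C A w)).
Notation Y A := (fun w => complex.Im (C A w)).

(** The covariance and the pseudo-covariance each give two real equations; these
    four equations determine the four products of real and imaginary parts.
    This is where the factor 1/2 comes from: the vanishing pseudo-covariance
    splits the variance equally between two uncorrelated components. *)
Lemma noise_component_products A B : admissible phi A -> admissible phi B ->
  let m := 2^-1 * fine (control_measure phi (A `&` B)) in
  [/\ inner_product P (X A) (X B) = m, inner_product P (Y A) (Y B) = m,
      inner_product P (X A) (Y B) = 0 & inner_product P (Y A) (X B) = 0].
Proof.
move=> Aa Ba /=.
have [XA YA] := grm_L2 C_noise Aa; have [XB YB] := grm_L2 C_noise Ba.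
have inte f g : f \in Lfun P 2%:E -> g \in Lfun P 2%:E ->
  P.-integrable setT (EFin \o (fun w => f w * g w)).
  exact: Lfun2_mul_integrable.
have [] := (grm_cov C_noise Aa Ba, grm_pseudocov C_noise Aa Ba).
rewrite /complex_expectation unlock => -[cRe cIm] [pRe pIm].
have : inner_product P (X A) (X B) + inner_product P (Y A) (Y B) =
    fine (control_measure phi (A `&` B)).
  rewrite -cRe -RintegralD//; try exact: inte.
  by apply: eq_Rintegral => w _; rewrite Re_mulc Re_conjc Im_conjc; ring.
have : inner_product P (Y A) (X B) - inner_product P (X A) (Y B) = 0.
  rewrite -[RHS]cIm -RintegralB//; try exact: inte.
  by apply: eq_Rintegral => w _; rewrite Im_mulc Re_conjc Im_conjc; ring.
have : inner_product P (X A) (X B) - inner_product P (Y A) (Y B) = 0.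
  rewrite -[RHS]pRe -RintegralB//; try exact: inte.
  by apply: eq_Rintegral => w _; rewrite Re_mulc.
have : inner_product P (X A) (Y B) + inner_product P (Y A) (X B) = 0.
  rewrite -[RHS]pIm -RintegralD//; try exact: inte.
  by apply: eq_Rintegral => w _; rewrite Im_mulc.
by move=> ? ? ? ?; split; lra.
Qed.

Lemma Re_simple_integral s : (fun w => complex.Re (simple_integral C s w)) =
  fun w => \sum_(p <- s) (complex.Re p.1 * X p.2 w - complex.Im p.1 * Y p.2 w).
Proof.
by apply/funext => w; rewrite Re_sumc; apply: eq_bigr => p _; rewrite Re_mulc.
Qed.

Lemma Im_simple_integral s : (fun w => complex.Im (simple_integral C s w)) =
  fun w => \sum_(p <- s) (complex.Re p.1 * Y p.2 w + complex.Im p.1 * X p.2 w).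
Proof.
by apply/funext => w; rewrite Im_sumc; apply: eq_bigr => p _; rewrite Im_mulc.
Qed.

Lemma simple_integral_L2 s : simple_admissible phi s ->
  complex_L2 P (simple_integral C s).
Proof.
move=> sa; split; rewrite ?Re_simple_integral ?Im_simple_integral;
  apply: Lfun2_sum => p /sa /(grm_L2 C_noise)[? ?];
  by [apply: Lfun2B; exact: Lfun2Z | apply: Lfun2D; exact: Lfun2Z].
Qed.

(** The cross products of real with imaginary parts vanish, which leaves
    (Re p.1 * Re q.1 + Im p.1 * Im q.1) / 2 times the measure of the overlap. *)
Lemma simple_integral_isometry s s' :
  simple_admissible phi s -> simple_admissible phi s' ->
  inner_product P (fun w => complex.Re (simple_integral C s w))
    (fun w => complex.Re (simple_integral C s' w)) =
  2^-1 * spectral_product phi (simple_fun s) (simple_fun s').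
Proof.
move=> sa s'a; rewrite spectral_product_simple// !Re_simple_integral.
have L2 (p : R[i] * set (plane R)) : admissible phi p.2 ->
    (fun w => complex.Re p.1 * X p.2 w - complex.Im p.1 * Y p.2 w)
    \in Lfun P 2%:E.
  by move=> /(grm_L2 C_noise)[? ?]; apply: Lfun2B; exact: Lfun2Z.
rewrite inner_product_sum => [|p /sa/L2//|p /s'a/L2//].
rewrite mulr_sumr big_seq [RHS]big_seq; apply: eq_bigr => p /sa pa.
rewrite mulr_sumr big_seq [RHS]big_seq; apply: eq_bigr => q /s'a qa.
have [? ?] := grm_L2 C_noise pa; have [? ?] := grm_L2 C_noise qa.
have [XX YY XY YX] := noise_component_products pa qa.
rewrite inner_productBl ?inner_productBr ?inner_productZl ?inner_productZr//;
  try exact: Lfun2Z; try exact: L2.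
by rewrite XX YY XY YX; ring.
Qed.

End simple_isometry.

(** * The isometry for stochastic integrals *)

Section stochastic_integral.
Context {R : realType} {d : measure_display} {Omega : measurableType d}.
Variables (P : probability Omega R) (phi : plane R -> R).
Variable C : set (plane R) -> Omega -> R[i].
Hypothesis phi_meas : measurable_fun half_plane phi.
Hypothesis phi_ge0 : forall z, half_plane z -> 0 <= phi z.
Hypothesis C_noise : gaussian_random_measure P phi C.

Lemma ms_cvg_Re (Zn : nat -> Omega -> R[i]) Z :
  (forall n, complex_L2 P (Zn n)) -> complex_L2 P Z -> ms_cvg P Zn Z ->
  let u n w := complex.Re (Zn n w) - complex.Re (Z w) in
  inner_product P (u n) (u n) @[n --> \oo] --> (0 : R).
Proof.
move=> ZnL [ZRe ZIm]; rewrite /ms_cvg unlock => e0 /=.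
have ZnRe n := (ZnL n).1; have ZnIm n := (ZnL n).2.
apply: (inner_product_sub_cvg0 ZnRe ZRe ZnIm ZIm).
move: e0; under eq_fun do under eq_integral do
  rewrite normc_sqr Re_subc Im_subc.
by [].
Qed.

(** Both sides are continuous for mean-square convergence, the left one on the
    probability space and the right one on the plane, so the identity passes
    from simple integrands to their limits. *)
Lemma stochastic_integral_isometry (f f' : plane R -> R[i]) Z Z' :
  spectral_L2 phi f -> spectral_L2 phi f' ->
  is_stochastic_integral P phi C f Z -> is_stochastic_integral P phi C f' Z' ->
  inner_product P (fun w => complex.Re (Z w)) (fun w => complex.Re (Z' w)) =
  2^-1 * spectral_product phi f f'.
Proof.
move=> fL f'L [ZL [s [sa sf sZ]]] [Z'L [s' [s'a s'f s'Z]]].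
have snL n := simple_integral_L2 C_noise (sa n).
have s'nL n := simple_integral_L2 C_noise (s'a n).
have : inner_product P (fun w => complex.Re (simple_integral C (s n) w))
    (fun w => complex.Re (simple_integral C (s' n) w)) @[n --> \oo] -->
    inner_product P (fun w => complex.Re (Z w)) (fun w => complex.Re (Z' w)).
  apply: inner_product_cvg.
  - by move=> n; case: (snL n).
  - by case: ZL.
  - by move=> n; case: (s'nL n).
  - by case: Z'L.
  - exact: ms_cvg_Re.
  - exact: ms_cvg_Re.
under eq_fun do
  rewrite (simple_integral_isometry phi_meas phi_ge0 C_noise (sa _) (s'a _)).
move=> /cvg_unique; apply => //.
apply: cvgM; first exact: cvg_cst.
by apply: spectral_product_cvg => // n; exact: simple_spectral_L2.
Qed.

End stochastic_integral.

(** * Damped exponentials *)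

Section damped_exponential.
Context {R : realType}.
Variable phi : plane R -> R.
Hypothesis phi_meas : measurable_fun half_plane phi.
Hypothesis phi_ge0 : forall z, half_plane z -> 0 <= phi z.

(** Rewrites the iterated integral over the half-plane as one over the whole
    plane, the form in which the Fubini and Tonelli theorems apply. *)
Lemma integral_half_planeE (h : plane R -> R) :
  (\int[lebesgue_measure]_(a in `]-oo, 0%R])
     \int[lebesgue_measure]_(omega in setT) (h (a, omega))%:E =
  \int[@lebesgue_measure R]_a \int[@lebesgue_measure R]_omega
     ((h \_ half_plane) (a, omega))%:E)%E.
Proof.
rewrite [LHS]integral_mkcond; apply: eq_integral => a _.
rewrite patchE; case: ifPn => aneg.
  apply: eq_integral => omega _; rewrite patchE mem_set//.
  by split => //; exact: set_mem.
rewrite integral0_eq// => omega _; rewrite patchE memNset// => -[/= a0 _].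
by move: aneg; rewrite mem_set.
Qed.

Lemma Re_damped_exponential t z :
  complex.Re (damped_exponential t z) =
  expR ((z.1 : R) * t) * cos ((z.2 : R) * t).
Proof. by rewrite Re_mulc /= mul0r subr0. Qed.

Lemma Im_damped_exponential t z :
  complex.Im (damped_exponential t z) =
  expR ((z.1 : R) * t) * sin ((z.2 : R) * t).
Proof. by rewrite Im_mulc /= mul0r addr0. Qed.

Lemma measurable_damped (c : R -> R) t : continuous c ->
  measurable_fun setT
    (fun z : plane R => expR ((z.1 : R) * t) * c ((z.2 : R) * t)).
Proof.
move=> cc; apply: measurable_funM.
  apply: measurableT_comp; first exact: measurable_expR.
  by apply: measurable_funM => //; exact: measurable_fst.
apply: measurableT_comp; first exact: continuous_measurable_fun.
by apply: measurable_funM => //; exact: measurable_snd.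
Qed.

(** By Tonelli, [well_defined_at] says that phi e^(2 alpha t) has a finite plane
    integral, and this function dominates the square; c is to be the cosine or
    the sine. *)
Lemma damped_Lfun2 (c : R -> R) t : continuous c -> (forall x, c x ^+ 2 <= 1) ->
  well_defined_at phi t ->
  weighted phi (fun z => expR ((z.1 : R) * t) * c ((z.2 : R) * t))
    \in Lfun leb2 2%:E.
Proof.
move=> cc c1 t_wd.
have mw := measurable_spectral_weight phi_meas.
have mf : measurable_fun setT
    (weighted phi (fun z => expR ((z.1 : R) * t) * c ((z.2 : R) * t))).
  by apply: measurable_funM => //; exact: measurable_damped.
have mh : measurable_fun setT
    ((fun z => phi z * expR (2 * (z.1 : R) * t)) \_ half_plane).
  apply/(measurable_restrictT _ _).1; first exact: measurable_half_plane.
  apply: measurable_funM => //; apply: (measurable_funS measurableT) => //.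
  apply: measurableT_comp; first exact: measurable_expR.
  by apply: measurable_funM => //; exact: measurable_funM.
have h0 z : 0 <= ((fun z => phi z * expR (2 * (z.1 : R) * t)) \_ half_plane) z.
  rewrite patchE; case: ifPn => // /set_mem/phi_ge0 p0.
  by rewrite mulr_ge0 ?expR_ge0.
apply: Lfun2_finite_sqr_integral => //; apply: le_lt_trans t_wd.
rewrite (integral_half_planeE (fun z => phi z * expR (2 * (z.1 : R) * t))).
rewrite -(fubini_tonelli1 (fun z =>
  (((fun z => phi z * expR (2 * (z.1 : R) * t)) \_ half_plane) z)%:E))
  /=; last 2 first.
- exact/measurable_EFinP.
- by move=> z; rewrite lee_fin.
apply: ge0_le_integral => //.
- by move=> z _; rewrite lee_fin sqr_ge0.
- by apply/measurable_EFinP; exact: measurable_funX.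
- exact/measurable_EFinP.
- move=> z _; rewrite lee_fin /weighted exprMn (spectral_weight_sqr phi_ge0).
  rewrite !patchE; case: ifPn => [/set_mem/phi_ge0 p0|]; last by rewrite mul0r.
  rewrite ler_wpM2l// exprMn -expRM_natl.
  rewrite [leRHS](_ : _ = expR (2 * (z.1 * t)) * 1); last first.
    by rewrite mulr1 mulrA.
  by rewrite ler_wpM2l ?expR_ge0.
Qed.

Lemma damped_exponential_spectral_L2 t : well_defined_at phi t ->
  spectral_L2 phi (damped_exponential t).
Proof.
move=> t_wd; split.
- rewrite (funext (Re_damped_exponential t)).
  apply: damped_Lfun2 (@continuous_cos R) _ t_wd => x.
  by rewrite -[leRHS](cos2Dsin2 x) lerDl sqr_ge0.
- rewrite (funext (Im_damped_exponential t)).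
  apply: damped_Lfun2 (@continuous_sin R) _ t_wd => x.
  by rewrite -[leRHS](cos2Dsin2 x) lerDr sqr_ge0.
Qed.

(** cos (omega (t - s)) is the real part of e^(j omega t) conj e^(j omega s),
    that is cos cos + sin sin. The integrand is integrable as a sum of products
    of square-integrable functions, hence Fubini applies. *)
Lemma spectral_product_damped_exponential t s :
  well_defined_at phi t -> well_defined_at phi s ->
  (spectral_product phi (damped_exponential t) (damped_exponential s))%:E =
  (\int[lebesgue_measure]_(alpha in `]-oo, 0%R])
      \int[lebesgue_measure]_(omega in setT)
        (phi (alpha, omega) * expR (alpha * (t + s)) *
         cos (omega * (t - s)))%:E)%E.
Proof.
move=> /damped_exponential_spectral_L2[tRe tIm].
move=> /damped_exponential_spectral_L2[sRe sIm].
have iRe := Lfun2_mul_integrable tRe sRe.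
have iIm := Lfun2_mul_integrable tIm sIm.
rewrite (integral_half_planeE (fun z =>
  phi z * expR ((z.1 : R) * (t + s)) * cos ((z.2 : R) * (t - s)))).
rewrite /spectral_product /inner_product -RintegralD//.
set h := (X in X \_ half_plane).
pose k z :=
  weighted phi (fun z => complex.Re (damped_exponential t z)) z *
  weighted phi (fun z => complex.Re (damped_exponential s z)) z +
  weighted phi (fun z => complex.Im (damped_exponential t z)) z *
  weighted phi (fun z => complex.Im (damped_exponential s z)) z.
have ik : leb2.-integrable setT (EFin \o k).
  exact: (integrableD measurableT iRe iIm).
have -> : h \_ half_plane = k.
  apply/funext => z; transitivity (spectral_weight phi z ^+ 2 *
      (expR ((z.1 : R) * (t + s)) * cos ((z.2 : R) * (t - s)))).
    rewrite (spectral_weight_sqr phi_ge0) !patchE /h.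
    by case: ifPn => _; rewrite ?mul0r// mulrA.
  rewrite /k /weighted !Re_damped_exponential !Im_damped_exponential.
  by rewrite mulrDr expRD mulrBr cosB; ring.
rewrite /Rintegral fineK; last exact: integrable_fin_num ik.
by rewrite -(integral12_prod_meas1 ik).
Qed.

End damped_exponential.

Theorem proposition1 (R : realType) (d : measure_display)
    (Omega : measurableType d) (P : probability Omega R)
    (phi : plane R -> R) (C : set (plane R) -> Omega -> R[i])
    (g : R -> Omega -> R)
    (phi_meas : measurable_fun half_plane phi)
    (phi_ge0 : forall alpha omega : R, alpha <= 0 -> 0 <= phi (alpha, omega))
    (phi_even : forall alpha omega : R, alpha <= 0 ->
       phi (alpha, omega) = phi (alpha, - omega))
    (C_noise : gaussian_random_measure P phi C)
    (g_def : damped_oscillation_process P phi C g)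
    (t s : R) (t_ge0 : 0 <= t) (s_ge0 : 0 <= s)
    (t_wd : well_defined_at phi t) (s_wd : well_defined_at phi s) :
  process_kernel P g t s =
  ((2^-1)%:E *
    \int[lebesgue_measure]_(alpha in `]-oo, 0%R])
      \int[lebesgue_measure]_(omega in setT)
        (phi (alpha, omega) * expR (alpha * (t + s)) *
         cos (omega * (t - s)))%:E)%E.
Proof.
have phi0 z : half_plane z -> 0 <= phi z.
  case: z => alpha omega [/= a0 _]; apply: phi_ge0.
  by move: a0; rewrite in_itv.
have [Z [ZC gt]] := g_def t t_ge0 t_wd.
have [Z' [Z'C gs]] := g_def s s_ge0 s_wd.
have ftL := damped_exponential_spectral_L2 phi_meas phi0 t_wd.
have fsL := damped_exponential_spectral_L2 phi_meas phi0 s_wd.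
rewrite -spectral_product_damped_exponential// -EFinM.
rewrite -(stochastic_integral_isometry phi_meas phi0 C_noise ftL fsL ZC Z'C).
rewrite /process_kernel gt gs unlock /inner_product /Rintegral fineK//.
apply: integrable_fin_num => //.
by apply: Lfun2_mul_integrable; [case: ZC => -[] | case: Z'C => -[]].
Qed.
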